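(* Let $f:\mathbb{R}^n\to\mathbb{R}$ be convex, continuously differentiable and locally strongly convex with locally Lipschitz gradient, with $\mathcal{X}^*:=\arg\min f\neq\emptyset$ and optimal value $f^*$. Fix $x^0$, $\alpha_0>0$, $\theta_0>0$, $\tau>1$, $0<\omega\le\frac1{\sqrt2}$, $\gamma_k\in[\gamma_{\min},\gamma_{\max}]\subset(0,\infty)$, and generate $x^{k+1}=x^k-\alpha_k\gamma_k\nabla f(x^k)$ with, for $k\ge1$, $L_k:=\frac{\|\nabla f(x^k)-\nabla f(x^{k-1})\|}{\|x^k-x^{k-1}\|}$, $\alpha_k:=\min\{\frac{\alpha_{k-1}\gamma_{k-1}}{\gamma_k}\sqrt{2(1-\omega^2)+\theta_{k-1}/\tau},\frac{\omega}{\gamma_kL_k}\}$, $\theta_k:=\frac{\alpha_k\gamma_k}{\alpha_{k-1}\gamma_{k-1}}$. Let $\eta:=\mathrm{dist}^2(x^0;\mathcal{X}^* )+2\alpha_0^2\gamma_0^2\|\nabla f(x^0)\|^2+2\alpha_0\gamma_0\theta_0(f(x^0)-f^* )$, $W:=\overline B(0;R)$ with $R>3\sqrt\eta+\mathrm{dist}(x^0;\mathcal{X}^* )+\|x^0\|$, let $L_W>0$ satisfy $\|\nabla f(x)-\nabla f(y)\|\le L_W\|x-y\|$ on $W$, and $\mu_W:=\inf_{x,y\in W,x\neq y}\frac{\langle\nabla f(y)-\nabla f(x),y-x\rangle}{\|y-x\|^2}$. Let $x^*\in\mathcal{X}^*$ and define $$\widehat{\mathcal L}(x^{k+1},x^k):=\|x^{k+1}-x^*\|^2+\Big(\tfrac{\omega^2}{1-\omega^2}+\tfrac{\mu_W}{2\omega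 L_W}\Big)\|x^{k+1}-x^k\|^2+2\alpha_k\gamma_k\Big(1+\tfrac{\theta_k}{2(1-\omega^2)}\Big)(f(x^k)-f^* ),$$ $$\hat q:=\min\Big\{\tfrac{\mu_W}{2}\min\{\alpha_0\gamma_0,\tfrac{\omega}{L_W}\},\ \tfrac{\mu_W(1-\omega^2)}{2\omega^3L_W+\mu_W(1-\omega^2)},\ \tfrac{(\tau-1)m}{\tau(2(1-\omega^2)+m)}\Big\},\quad m:=\min\{\tfrac{\alpha_0\gamma_0\mu_W}{\omega},\tfrac{\mu_W}{L_W}\}.$$ Then $\hat q\in(0,1)$ and $\widehat{\mathcal L}(x^{k+1},x^k)\le(1-\hat q)\widehat{\mathcal L}(x^k,x^{k-1})$ for all $k\in\mathbb{N}$.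
   Context: AdaSGA setting. $f$ is locally strongly convex if every $x$ has $\delta_x>0$, $\mu_x>0$ with $f(y)\ge f(z)+\langle\nabla f(z),y-z\rangle+\frac{\mu_x}{2}\|y-z\|^2$ for all $y,z\in B(x;\delta_x)$. $\mathrm{dist}(x;S)=\inf_{z\in S}\|z-x\|$. *)

(* Defs.v *)
From HB Require Import structures.
From mathcomp Require Import all_boot all_order all_algebra.
From mathcomp Require Import all_classical all_reals all_analysis.
Set Implicit Arguments. Unset Strict Implicit. Unset Printing Implicit Defensive.
Import Order.TTheory GRing.Theory Num.Theory.
Import numFieldNormedType.Exports.
Local Open Scope classical_set_scope.
Local Open Scope ring_scope.

Section Defs.
Variables (R : realType) (n : nat).
Local Notation V := 'rV[R]_n.

Definition dot (u v : V) : R := \sum_(i < n) u ord0 i * v ord0 i.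
Definition enorm (v : V) : R := Num.sqrt (dot v v).

Definition dist_set (x : V) (S : set V) : R := inf [set enorm (z - x) | z in S].

Definition is_gradient (f : V -> R) (g : V -> V) : Prop :=
  forall x, differentiable f x /\ forall h, 'd f x h = dot (g x) h.

Definition convex_fun (f : V -> R) : Prop :=
  forall (x y : V) (t : R), 0 <= t <= 1 ->
    f (t *: x + (1 - t) *: y) <= t * f x + (1 - t) * f y.

Definition locally_strongly_convex (f : V -> R) (g : V -> V) : Prop :=
  forall x : V, exists delta mu : R, 0 < delta /\ 0 < mu /\
    forall y z : V, enorm (y - x) < delta -> enorm (z - x) < delta ->
      f z + dot (g z) (y - z) + mu / 2 * (enorm (y - z)) ^+ 2 <= f y.

Definition locally_lipschitz (g : V -> V) : Prop :=
  forall x : V, exists delta L : R, 0 < delta /\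
    forall y z : V, enorm (y - x) < delta -> enorm (z - x) < delta ->
      enorm (g y - g z) <= L * enorm (y - z).

Definition argmin (f : V -> R) : set V := [set x | forall y, f x <= f y].

End Defs.

(* Main.v *)
Require Import Defs.
From HB Require Import structures.
From mathcomp Require Import all_boot all_order all_algebra.
From mathcomp Require Import all_classical all_reals all_analysis.
From mathcomp Require Import ring lra.
Import Order.TTheory GRing.Theory Num.Theory.
Import numFieldNormedType.Exports.
Local Open Scope classical_set_scope.
Local Open Scope ring_scope.

(* Write s_k = alpha_k gamma_k, D_k = |x_k - x*|^2 and F_k = f(x_k) - f*.
   Without any strong convexity constant, the function
     D_{k+1} + omega^2/(1-omega^2) |x_{k+1}-x_k|^2 + s_k (2 + theta_k/(1-omega^2)) F_k
   is nonincreasing, so the iterates stay in W, where compactness makes the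
   gradient strongly monotone with constant mu_W > 0.  Redoing the one-step
   estimate with mu_W and with cocoercivity at x* leaves three terms to compare
   with (1 - q) times the previous value.  The F-term is the delicate one, because
   theta_{k-1} has no useful lower bound for k = 1, 2 (theta_0 is arbitrary).
   Either theta_k^2 <= (1-q)(2(1-omega^2) + theta_{k-1}), and the F-terms already
   contract; or theta_k^2 >= 2(1-omega^2)(1-q), in which case the excess is at most
   2 q s_{k-1} F_{k-1}, which strong convexity at x_{k-1} bounds by the slack of
   the two quadratic terms. *)

Set Implicit Arguments.
Unset Strict Implicit.

(** * Euclidean inner product and norm, compared with the max norm *)

Section Euclidean.
Variables (R : realType) (n : nat).
Implicit Types u v w : 'rV[R]_n.

Lemma dotC u v : dot u v = dot v u.
Proof. by apply: eq_bigr => i _; rewrite mulrC. Qed.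

Lemma dotDl u v w : dot (u + v) w = dot u w + dot v w.
Proof. by rewrite -big_split; apply: eq_bigr => i _; rewrite mxE mulrDl. Qed.

Lemma dotZl a u v : dot (a *: u) v = a * dot u v.
Proof. by rewrite /dot mulr_sumr; apply: eq_bigr => i _; rewrite mxE mulrA. Qed.

Lemma dotNl u v : dot (- u) v = - dot u v.
Proof. by rewrite -scaleN1r dotZl mulN1r. Qed.

Lemma dotBl u v w : dot (u - v) w = dot u w - dot v w.
Proof. by rewrite dotDl dotNl. Qed.

Lemma dotDr u v w : dot u (v + w) = dot u v + dot u w.
Proof. by rewrite dotC dotDl !(dotC u). Qed.

Lemma dotZr a u v : dot u (a *: v) = a * dot u v.
Proof. by rewrite dotC dotZl dotC. Qed.

Lemma dotNr u v : dot u (- v) = - dot u v.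
Proof. by rewrite dotC dotNl dotC. Qed.

Lemma dotBr u v w : dot u (v - w) = dot u v - dot u w.
Proof. by rewrite dotDr dotNr. Qed.

Lemma dot0l v : dot 0 v = 0.
Proof. by rewrite -(scale0r 0) dotZl mul0r. Qed.

Definition dotE := (dotDl, dotDr, dotBl, dotBr, dotZl, dotZr, dotNl, dotNr).

Lemma dot_ge0 u : 0 <= dot u u.
Proof. by apply: sumr_ge0 => i _; rewrite -expr2 sqr_ge0. Qed.

Lemma dot_eq0 u : dot u u = 0 -> u = 0.
Proof.
move=> /eqP; rewrite psumr_eq0 => [/allP u0|i _]; last by rewrite -expr2 sqr_ge0.
apply/rowP => i; rewrite mxE; apply/eqP.
by have := u0 i (mem_index_enum i); rewrite -expr2 sqrf_eq0.
Qed.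

Lemma enorm_ge0 u : 0 <= enorm u.
Proof. exact: sqrtr_ge0. Qed.

Lemma sqr_enorm u : enorm u ^+ 2 = dot u u.
Proof. by rewrite sqr_sqrtr ?dot_ge0. Qed.

Lemma enorm0 : enorm (0 : 'rV[R]_n) = 0.
Proof. by rewrite /enorm dot0l sqrtr0. Qed.

Lemma enorm_gt0 u : u != 0 -> 0 < enorm u.
Proof.
move=> u0; rewrite lt_neqAle enorm_ge0 andbT eq_sym; apply: contra u0 => /eqP u0.
by apply/eqP/dot_eq0; rewrite -sqr_enorm u0 expr0n.
Qed.

Lemma enormN u : enorm (- u) = enorm u.
Proof. by rewrite /enorm !dotE opprK. Qed.

Lemma enormB u v : enorm (u - v) = enorm (v - u).
Proof. by rewrite -enormN opprB. Qed.

Lemma enormZ a u : enorm (a *: u) = `|a| * enorm u.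
Proof. by rewrite /enorm !dotE mulrA -expr2 sqrtrM ?sqr_ge0 // sqrtr_sqr. Qed.

(** Cauchy-Schwarz: expand the square of [|v| u - |u| v] and divide by [|u| |v|]. *)
Lemma dot_le_enorm u v : dot u v <= enorm u * enorm v.
Proof.
have [->|u0] := eqVneq u 0; first by rewrite dot0l enorm0 mul0r.
have [->|v0] := eqVneq v 0; first by rewrite dotC dot0l enorm0 mulr0.
have := dot_ge0 (enorm v *: u - enorm u *: v).
rewrite !dotE -!sqr_enorm (dotC v u).
have := mulr_gt0 (enorm_gt0 u0) (enorm_gt0 v0).
set a := enorm u; set b := enorm v => ab ?.
by rewrite -(ler_pM2l ab); nra.
Qed.

Lemma enormD u v : enorm (u + v) <= enorm u + enorm v.
Proof.
rewrite -(@ler_pXn2r _ 2) ?nnegrE ?addr_ge0 ?enorm_ge0 //.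
rewrite sqr_enorm !dotE -!sqr_enorm (dotC v u).
have := dot_le_enorm u v; nra.
Qed.

Lemma enorm_le_sqr u (c : R) : 0 <= c -> dot u u <= c ^+ 2 -> enorm u <= c.
Proof.
by move=> c0 uc; rewrite -(@ler_pXn2r _ 2) ?nnegrE ?enorm_ge0 // sqr_enorm.
Qed.

Lemma enorm_line (y d : 'rV[R]_n) (t c : R) : 0 <= t <= 1 ->
  enorm y <= c -> enorm (y + d) <= c -> enorm (y + t *: d) <= c.
Proof.
move=> /andP[t0 t1] yc ydc.
have -> : y + t *: d = (1 - t) *: y + t *: (y + d).
  by rewrite scalerBl scale1r scalerDr addrA subrK.
apply: le_trans (enormD _ _) _; rewrite !enormZ (ger0_norm t0) ger0_norm ?subr_ge0 //.
by nra.
Qed.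

(** The topology on row vectors comes from the max norm; this bound and [enorm_le_norm] transfer
    compactness to Euclidean balls. *)
Lemma norm_le_enorm u : `|u| <= enorm u.
Proof.
rewrite [leLHS]/Num.Def.normr/= mx_normrE (bigmax_le _ (enorm_ge0 u)) //= => -[i j] _.
rewrite /= (ord1 i) -sqrtr_sqr ler_wsqrtr // /dot (bigD1 j) //= -expr2 lerDl.
by apply: sumr_ge0 => k _; rewrite -expr2 sqr_ge0.
Qed.

Lemma enorm_le_norm u : enorm u <= n%:R * `|u|.
Proof.
have coord i : `|u ord0 i| <= `|u|.
  rewrite [leRHS]/Num.Def.normr /= mx_normrE.
  exact: (le_bigmax _ (fun ij => `|u ij.1 ij.2|) (ord0, i)).
apply: enorm_le_sqr; first by rewrite mulr_ge0.
apply: (@le_trans _ _ (n%:R * `|u| ^+ 2)).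
  have -> : n%:R * `|u| ^+ 2 = \sum_(i < n) `|u| ^+ 2 by rewrite sumr_const card_ord mulr_natl.
  apply: ler_sum => i _.
  by rewrite -expr2 -real_normK ?num_real// lerXn2r ?nnegrE.
rewrite exprMn ler_wpM2r ?sqr_ge0 // -natrX ler_nat.
by case: (n) => // k; rewrite expnS expn1 leq_pmull.
Qed.

End Euclidean.

(** * Inequalities for [f] along segments and at minimizers *)

Section Line.
Variables (R : realType) (n : nat) (f : 'rV[R]_n -> R) (g : 'rV[R]_n -> 'rV[R]_n).
Hypothesis fg : is_gradient f g.

Lemma is_derive_line (z d : 'rV[R]_n) (t : R) :
  is_derive t 1 (fun s => f (z + s *: d)) (dot (g (z + t *: d)) d).
Proof.
have [df dE] := fg (z + t *: d).
have fdrv : derivable f (z + t *: d) d by exact: diff_derivable.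
have quotE : (fun h : R => h^-1 *: (f (z + (h *: 1 + t) *: d) - f (z + t *: d)))
    = (fun h : R => h^-1 *: (f (h *: d + (z + t *: d)) - f (z + t *: d))).
  apply/funext => h; congr (_ *: (f _ - _)).
  by rewrite [h *: 1]mulr1 scalerDl addrCA.
by apply: DeriveDef; rewrite ?/derivable ?/derive /= quotE // -dE -deriveE.
Qed.

(** Mean value theorem for [f (z + s d)] minus a linear and a quadratic term in [s]. With [v = g z],
    the sign of the right side yields either strong convexity or the descent inequality. *)
Lemma line_MVT (c : R) (z d v : 'rV[R]_n) :
  exists2 t : R, 0 <= t <= 1 &
    f (z + d) - f z - dot v d - c / 2 * dot d d =
    dot (g (z + t *: d) - v) d - c * t * dot d d.
Proof.
pose h : R -> R := (fun s => f (z + s *: d)) - (dot v d \*: id)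
   - (c / 2 * dot d d) \*: (id ^+ 2).
have dh (t : R) : is_derive t 1 h (dot (g (z + t *: d) - v) d - c * t * dot d d).
  have dl := is_derive_line z d t.
  apply: is_derive_eq.
  rewrite !dotE /GRing.scale /= expr1; lra.
have hE (s : R) : h s = f (z + s *: d) - s * dot v d - c / 2 * s ^+ 2 * dot d d.
  rewrite /h !fctE; congr (f _ - _ - _); first exact: mulrC.
  by rewrite [LHS]/GRing.scale /=; ring.
have ch : {within `[0 : R, 1], continuous h}.
  apply: derivable_within_continuous => t _; exact: ex_derive.
have [t t01 E] := @MVT_segment R h _ 0 1 ler01 (fun t _ => dh t) ch.
exists t; first by rewrite in_itv in t01.
by move: E; rewrite !hE !scale1r scale0r addr0 subr0; lra.
Qed.

Lemma strong_convexity_ball (r c : R) :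
  (forall y z, enorm y <= r -> enorm z <= r ->
     c * dot (z - y) (z - y) <= dot (g z - g y) (z - y)) ->
  forall y z, enorm y <= r -> enorm z <= r ->
  f z + dot (g z) (y - z) + c / 2 * dot (y - z) (y - z) <= f y.
Proof.
move=> gmono y z yr zr; set d := y - z.
have zd : z + d = y by rewrite addrC subrK.
have [t /andP[t0 t1] E] := line_MVT c z d (g z).
suff : 0 <= dot (g (z + t *: d) - g z) d - c * t * dot d d by rewrite -E zd; lra.
(* The mean value point may be 0, whereas monotonicity between [z] and [z + t d] gives the claim
   only after division by [t]. *)
have [->|tn0] := eqVneq t 0; first by rewrite scale0r addr0 subrr dot0l; lra.
have tgt0 : 0 < t by rewrite lt_neqAle eq_sym tn0.
have ztd : enorm (z + t *: d) <= r by apply: enorm_line; rewrite ?zd // t0.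
have := gmono _ _ zr ztd; rewrite addrC addKr dotZl !dotZr => ?.
by rewrite -(ler_pM2l tgt0) mulr0; lra.
Qed.

Lemma descent_ball (r L : R) :
  (forall y z, enorm y <= r -> enorm z <= r -> enorm (g y - g z) <= L * enorm (y - z)) ->
  forall y z, enorm y <= r -> enorm z <= r ->
  f y <= f z + dot (g z) (y - z) + L / 2 * dot (y - z) (y - z).
Proof.
move=> glip y z yr zr; set d := y - z.
have zd : z + d = y by rewrite addrC subrK.
have [t /andP[t0 t1] E] := line_MVT L z d (g z).
suff : dot (g (z + t *: d) - g z) d - L * t * dot d d <= 0 by rewrite -E zd; lra.
have ztd : enorm (z + t *: d) <= r by apply: enorm_line; rewrite ?zd // t0.
have := glip _ _ ztd zr; rewrite [X in _ * enorm X]addrC addKr enormZ (ger0_norm t0) => Hlip.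
have := dot_le_enorm (g (z + t *: d) - g z) d.
have := ler_wpM2r (enorm_ge0 d) Hlip; rewrite -sqr_enorm expr2; lra.
Qed.

Hypothesis fconv : convex_fun f.
Hypothesis flsc : locally_strongly_convex f g.

(* Local strong convexity supplies the inequality at a point of the segment
   close to z; convexity carries it to the endpoint. *)
Lemma convex_gradient_le z y : f z + dot (g z) (y - z) <= f y.
Proof.
have [delta [mu [d0 [mu0 H]]]] := flsc z.
have Ed : 0 < enorm (y - z) + 1 by rewrite ltr_wpDl ?enorm_ge0.
pose t := Num.min 1 (delta / 2 / (enorm (y - z) + 1)).
have t0 : 0 < t by rewrite lt_min ltr01 !divr_gt0.
have t1 : t <= 1 by rewrite ge_min lexx.
have tE : t * (enorm (y - z) + 1) <= delta / 2.
  by rewrite -ler_pdivlMr // ge_min lexx orbT.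
have zt : t *: y + (1 - t) *: z - z = t *: (y - z).
  by rewrite scalerBl scale1r scalerBr addrA addrAC addrK.
have := H (t *: y + (1 - t) *: z) z; rewrite zt subrr enorm0 => /(_ _ d0).
have E0 := enorm_ge0 (y - z).
rewrite enormZ (gtr0_norm t0) dotZr => Hl.
have t01 : 0 <= t <= 1 by rewrite (ltW t0).
have h1 : t * enorm (y - z) < delta by lra.
have := le_trans (Hl h1) (fconv y z t01).
have : 0 <= mu / 2 * (t * enorm (y - z)) ^+ 2 by rewrite mulr_ge0 ?sqr_ge0 // divr_ge0 // ltW.
by move=> ? ?; rewrite -(ler_pM2l t0); lra.
Qed.

Lemma gradient_monotone y z : 0 <= dot (g z - g y) (z - y).
Proof.
have := convex_gradient_le z y; have := convex_gradient_le y z.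
by rewrite -(opprB z y) dotNr dotBl; lra.
Qed.

Hypothesis glip : locally_lipschitz g.

(** Along a short step from [xs] to [z = xs - t v] the gradient changes by at most [|v| / 2], so
    [<g z, v> >= |v|^2 / 2]; convexity at [z] and minimality of [xs] make this product
    nonpositive. *)
Lemma argmin_gradient xs : argmin f xs -> g xs = 0.
Proof.
move=> xsmin; have [delta [L [d0 HL]]] := glip xs.
set v := g xs; apply: dot_eq0.
have E0 := enorm_ge0 v.
pose M := enorm v + 1.
(* The first bound keeps [z] within [delta] of [xs], the second gives [t L <= 1/2]; adding 1 avoids
   zero denominators. *)
pose t := Num.min (delta / 2 / M) (1 / 2 / (`|L| + 1)).
have M0 : 0 < M by rewrite /M; lra.
have L1 : 0 < `|L| + 1 by rewrite ltr_wpDl.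
have t0 : 0 < t by rewrite lt_min !divr_gt0.
have tM : t * M <= delta / 2 by rewrite -ler_pdivlMr // ge_min lexx.
have tL : t * (`|L| + 1) <= 1 / 2 by rewrite -ler_pdivlMr // ge_min lexx orbT.
pose z := xs - t *: v.
have := convex_gradient_le z xs.
have -> : xs - z = t *: v by rewrite opprB addrC subrK.
have zx : enorm (z - xs) = t * enorm v.
  by rewrite /z addrC addKr enormN enormZ gtr0_norm.
have := HL z xs; rewrite zx subrr enorm0 => /(_ _ d0) Hl.
have {}Hl : enorm (g z - v) <= L * (t * enorm v) by apply: Hl; rewrite /M in tM; nra.
have := xsmin z; have := dot_le_enorm (v - g z) v; rewrite (enormB v) dotBl dotZr.
have := ler_wpM2r E0 Hl; have := dot_ge0 v; rewrite -sqr_enorm.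
have : t * L <= 1 / 2.
  by apply: le_trans tL; rewrite ler_pM2l //; apply: le_trans (ler_norm _) _; rewrite lerDl.
move=> tL2 h0 h1 h2 h3 h4.
have h5 : dot (g z) v <= 0 by rewrite -(ler_pM2l t0); lra.
have h6 : t * L * enorm v ^+ 2 <= 1 / 2 * enorm v ^+ 2 by rewrite ler_wpM2r.
lra.
Qed.

(** At a point of the segment close to [xs], strong convexity with zero gradient puts [f] above the
    minimum by a multiple of [|ys - xs|^2], but convexity keeps it at the minimum. *)
Lemma argmin_unique xs ys : argmin f xs -> argmin f ys -> ys = xs.
Proof.
move=> xm ym; have [delta [mu [d0 [mu0 H]]]] := flsc xs.
have Ed : 0 < enorm (ys - xs) + 1 by rewrite ltr_wpDl ?enorm_ge0.
pose t := Num.min 1 (delta / 2 / (enorm (ys - xs) + 1)).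
have t0 : 0 < t by rewrite lt_min ltr01 !divr_gt0.
have t1 : t <= 1 by rewrite ge_min lexx.
have tE : t * (enorm (ys - xs) + 1) <= delta / 2.
  by rewrite -ler_pdivlMr // ge_min lexx orbT.
have zt : t *: ys + (1 - t) *: xs - xs = t *: (ys - xs).
  by rewrite scalerBl scale1r scalerBr addrA addrAC addrK.
have := H (t *: ys + (1 - t) *: xs) xs; rewrite zt subrr enorm0 => /(_ _ d0).
rewrite (argmin_gradient xm) dot0l enormZ (gtr0_norm t0) => Hs.
have t01 : 0 <= t <= 1 by rewrite (ltW t0).
have h1 : t * enorm (ys - xs) < delta by have := enorm_ge0 (ys - xs); lra.
have := le_trans (Hs h1) (fconv ys xs t01); have := ym xs.
move=> h2 h3.
have h4 : mu / 2 * (t * enorm (ys - xs)) ^+ 2 <= 0 by nra.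
apply/eqP; rewrite -subr_eq0; apply: contraTT h4 => /enorm_gt0 ?.
by rewrite -ltNge mulr_gt0 ?divr_gt0 // exprn_gt0 // mulr_gt0.
Qed.

End Line.

(** * Strong monotonicity of the gradient on balls, by compactness *)

Section UniformMonotonicity.
Variables (R : realType) (n : nat) (f : 'rV[R]_n -> R) (g : 'rV[R]_n -> 'rV[R]_n).

Lemma locally_strongly_monotone (x : 'rV[R]_n) : locally_strongly_convex f g ->
  exists delta mu : R, [/\ 0 < delta, 0 < mu & forall y z,
    enorm (y - x) < delta -> enorm (z - x) < delta ->
    mu * dot (z - y) (z - y) <= dot (g z - g y) (z - y)].
Proof.
move=> /(_ x)[delta [mu [d0 [mu0 H]]]]; exists delta, mu; split => // y z yx zx.
have := H _ _ yx zx; have := H _ _ zx yx; rewrite !sqr_enorm.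
rewrite -(opprB z y) !dotNr !dotNl [dot (g z - g y) _]dotBl; lra.
Qed.

Lemma box_compact (r : R) : compact [set x : 'rV[R]_n | `|x| <= r].
Proof.
apply: bounded_closed_compact.
  exists r; split => [|M rM x /= xr]; first exact: num_real.
  exact: le_trans xr (ltW rM).
rewrite [X in closed X](_ : _ = Num.norm @^-1` [set t : R | t <= r])//.
by apply: closed_comp => [x _|]; [exact: norm_continuous|exact: closed_le].
Qed.

(** One number [e] serves as both radius and modulus, so the local property holds for all small
    [e > 0] near each point, and compactness makes the smallness uniform. *)
Lemma uniformly_locally_strongly_monotone (r : R) : locally_strongly_convex f g ->
  exists2 e : R, 0 < e & forall x y z : 'rV[R]_n, enorm x <= r ->
    enorm (y - x) < e -> enorm (z - x) < e ->
    e * dot (z - y) (z - y) <= dot (g z - g y) (z - y).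
Proof.
move=> lsc.
pose P (e : R) (x : 'rV[R]_n) := forall y z : 'rV[R]_n,
  enorm (y - x) < e -> enorm (z - x) < e ->
  e * dot (z - y) (z - y) <= dot (g z - g y) (z - y).
have [x _|e0 /= e00 He0] := (compact_near_coveringP _).1 (@box_compact r) R (0 : R)^'+ P _.
  have [delta [mu [d0 mu0 H]]] := locally_strongly_monotone x lsc.
  have N0 : (0 : R) < n%:R + 1 by rewrite ltr_wpDl.
  (* This is a max-norm ball; the factor [n + 1] places it within Euclidean distance [delta / 2] of
     [x]. *)
  exists (ball x (delta / 2 / (n%:R + 1)), [set e : R | [/\ 0 < e, e < mu & e < delta / 2]]).
    split => /=; first by apply: nbhsx_ballx; rewrite !divr_gt0.
    near=> e; split; near: e; [exact: nbhs_right_gt|exact: nbhs_right_lt|].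
    by apply: nbhs_right_lt; rewrite divr_gt0.
  move=> [x' e] /= [xx' [e0 emu ed]] y z yx' zx'.
  have xd : enorm (x' - x) <= delta / 2.
    move: xx'; rewrite -ball_normE /= => xx'.
    rewrite enormB; apply: le_trans (enorm_le_norm _) _.
    move: xx'; rewrite ltr_pdivlMr // => xx'.
    by have := normr_ge0 (x - x'); nra.
  have close w : enorm (w - x') < e -> enorm (w - x) < delta.
    move=> wx'; have := enormD (w - x') (x' - x); rewrite addrA subrK; lra.
  apply: le_trans (H _ _ (close _ yx') (close _ zx')).
  by rewrite ler_wpM2r ?dot_ge0 // ltW.
exists (e0 / 2); first by rewrite divr_gt0.
move=> x y z xr; apply: He0; rewrite ?divr_gt0 //=.
  by rewrite sub0r normrN gtr0_norm ?divr_gt0 // ltr_pdivrMr // ltr_pMr // ltr1n.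
exact: le_trans (norm_le_enorm _) xr.
Unshelve. all: by end_near.
Qed.

(** The segment is cut into [N + 1] equal pieces shorter than the uniform radius [c]; the local
    inequalities telescope to the global one with the same [c]. *)
Lemma strongly_monotone_ball (r : R) : locally_strongly_convex f g ->
  exists2 c : R, 0 < c & forall y z : 'rV[R]_n, enorm y <= r -> enorm z <= r ->
    c * dot (z - y) (z - y) <= dot (g z - g y) (z - y).
Proof.
move=> /(uniformly_locally_strongly_monotone r)[c c0 H]; exists c => // y z yr zr.
have [N] : exists N : nat, enorm (z - y) < N.+1%:R * c.
  exists (Num.truncn (enorm (z - y) / c)).
  by rewrite -ltr_pdivrMr // truncnS_gt.
move=> HN.
have N0 : (0 : R) < N.+1%:R by rewrite ltr0n.
pose p (i : nat) := y + (i%:R / N.+1%:R) *: (z - y).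
have pS i : p i.+1 - p i = N.+1%:R^-1 *: (z - y).
  rewrite /p opprD addrACA subrr add0r -scalerBl -mulrBl -natrB //.
  by rewrite subSnn mul1r.
have pr i : (i <= N.+1)%N -> enorm (p i) <= r.
  move=> iN; apply: enorm_line => //; last by rewrite addrC subrK.
  by rewrite divr_ge0 ?ler0n //= ler_pdivrMr // mul1r ler_nat.
have step i : (i < N.+1)%N ->
    c * (N.+1%:R^-1 * dot (z - y) (z - y)) <= dot (g (p i.+1) - g (p i)) (z - y).
  move=> iN; have := H (p i) (p i) (p i.+1) (pr _ (ltnW iN)).
  rewrite subrr enorm0 pS enormZ => /(_ c0).
  rewrite gtr0_norm ?invr_gt0 // dotZr !dotZl dotZr mulrC ltr_pdivrMr // [c * N.+1%:R]mulrC.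
  move=> /(_ HN) h.
  by move: h; rewrite (mulrCA c) ler_pM2l ?invr_gt0.
have pE0 : p 0 = y by rewrite /p mul0r scale0r addr0.
have pEN : p N.+1 = z by rewrite /p divff ?gt_eqF // scale1r addrC subrK.
have sumE k : \sum_(0 <= i < k) dot (g (p i.+1) - g (p i)) (z - y) =
    dot (g (p k) - g (p 0)) (z - y).
  elim: k => [|k IH]; first by rewrite big_geq // subrr dot0l.
  by rewrite big_nat_recr //= IH -dotDl addrC addrA subrK.
have -> : g z - g y = g (p N.+1) - g (p 0) by rewrite pE0 pEN.
rewrite -sumE; apply: (@le_trans _ _ (\sum_(0 <= i < N.+1) c * (N.+1%:R^-1 * dot (z - y) (z - y)))).
  by rewrite sumr_const_nat subn0 -[leRHS]mulr_natl (mulrCA _ c) mulVKf ?gt_eqF.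
by rewrite !big_mkord; apply: ler_sum => i _; apply: step.
Qed.

End UniformMonotonicity.

(** * The one-step estimate and the scalar inequalities behind the contraction *)

Section OneStep.
Variable R : realType.

(* [s * s * |g|^2] is split as [|g - g_|^2 + <g, g_> + <g - g_, g_>]; the three
   terms are controlled by the step-size rule, by convexity between the two
   iterates and by monotonicity of the gradient. *)
Lemma lyapunov_one_step n (x x_ xs g g_ : 'rV[R]_n) (s s_ th om ka mu e r F F_ : R) :
  0 <= s -> 0 <= th -> s = th * s_ -> x = x_ - s_ *: g_ ->
  0 <= ka -> ka * (1 - om ^+ 2) = 1 ->
  s ^+ 2 * dot (g - g_) (g - g_) <= om ^+ 2 * dot (x - x_) (x - x_) ->
  F + dot g (x_ - x) + mu / 2 * dot (x_ - x) (x_ - x) <= F_ ->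
  mu * dot (x - x_) (x - x_) <= dot (g - g_) (x - x_) ->
  2 * s * F + r * dot (x - xs) (x - xs) + e * s ^+ 2 * dot g g <=
    2 * s * dot g (x - xs) ->
  dot (x - s *: g - xs) (x - s *: g - xs)
    + (ka * om ^+ 2 + e) * (s ^+ 2 * dot g g) + s * (2 + ka * th) * F
  <= (1 - r) * dot (x - xs) (x - xs)
     + ka * (om ^+ 2 - 3 / 2 * s * th * mu) * dot (x - x_) (x - x_)
     + ka * s * th * F_.
Proof.
move=> s0 th0 sE xE ka0 kaE hL hF hM hC.
have dE : x - x_ = - (s_ *: g_) by rewrite xE addrC addKr.
have dE' : x_ - x = s_ *: g_ by rewrite -opprB dE opprK.
have dxE : x - s *: g - xs = (x - xs) - s *: g by rewrite addrAC.
move: hL hF hM hC; rewrite dxE dE dE' !dotE (dotC g_ g) (dotC x g) (dotC xs g).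
set a := dot g g; set b := dot g g_; set c := dot g_ g_ => hL hF hM hC.
have hM' := ler_wpM2l (mulr_ge0 s0 th0) hM.
have hF' := ler_wpM2l (mulr_ge0 s0 th0) hF.
have K : s ^+ 2 * a <= (om ^+ 2 - 3 / 2 * s * th * mu) * (s_ ^+ 2 * c) + s * th * (F_ - F).
  subst s; nra.
have := ler_wpM2l ka0 K.
(* The square of the step occurs once in the expanded distance and [ka om^2] times in the Lyapunov
   term, which totals [ka]. *)
have : ka * (s ^+ 2 * a) = s ^+ 2 * a + ka * om ^+ 2 * (s ^+ 2 * a).
  have {1}-> : ka = 1 + ka * om ^+ 2 by lra.
  by ring.
lra.
Qed.

(** Here [u] and [v] are the old and new step times [mu]. The two final bounds say that the slack of
    the distance term and of the increment term absorbs the excess of the F-term. *)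
Lemma case_two (u v om q th : R) :
  0 < u -> 0 <= q -> 0 < om -> om ^+ 2 <= 1 / 2 -> 0 <= th -> v = th * u -> v <= om ->
  q <= u / 2 -> q <= v / 2 -> 2 * (1 - om ^+ 2) * (1 - q) <= th ^+ 2 ->
  [/\ u < 1, q * (1 - u) * (7 / 5) <= v * (1 - v / (2 * om)) &
      q * (5 / 2 * (1 - u) + 2 - u) * (1 - om ^+ 2) <= 3 / 2 * th * v].
Proof.
move=> u0 q0 om0 om2 th0 vE vom qu qv hth.
have om1 : om < 71 / 100 by nra.
have v2 : 2 * (1 - om ^+ 2) * (1 - q) * u ^+ 2 <= v ^+ 2.
  by rewrite vE exprMn; apply: ler_wpM2r; rewrite ?sqr_ge0.
(* Since [q <= v/2 <= om/2], the factor [1 - q] exceeds [16/25]; hence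
   [u <= 5/4 v <= 5/4 om < 1]. *)
have u1 : u < 1.
  have h : 1 - q <= 2 * (1 - om ^+ 2) * (1 - q) by nra.
  have h2 : 16 / 25 * u ^+ 2 <= v ^+ 2 by nra.
  by nra.
have v0 : 0 <= v by rewrite vE mulr_ge0 // ltW.
split => //; last first.
  have h1 : q * (5 / 2 * (1 - u) + 2 - u) * (1 - om ^+ 2) <=
      u / 2 * (5 / 2 * (1 - u) + 2 - u) * (1 - om ^+ 2).
    by rewrite ler_wpM2r ?ler_wpM2r //; nra.
  apply: le_trans h1 _.
  have -> : 3 / 2 * th * v = 3 / 2 * u * th ^+ 2 by rewrite vE; ring.
  have h3 : 2 * (1 - om ^+ 2) * (1 - u / 2) <= th ^+ 2 by nra.
  have := ler_wpM2l (ltW u0) h3.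
  have o1 : 0 <= u * (1 - om ^+ 2) by rewrite mulr_ge0; lra.
  have := mulr_ge0 (ltW u0) o1; lra.
apply: (@le_trans _ _ (7 / 10 * u * (1 - u))); first by nra.
pose k := v / om.
have kE : v = k * om by rewrite /k divfK ?gt_eqF.
have k1 : k <= 1 by rewrite /k ler_pdivrMr // mul1r.
have k0 : 0 <= k by rewrite /k divr_ge0 // ltW.
have -> : v / (2 * om) = k / 2 by rewrite /k; field; rewrite gt_eqF.
have v2' : 2 * (1 - om ^+ 2) * (1 - u / 2) * u ^+ 2 <= v ^+ 2.
  apply: le_trans v2; rewrite ler_wpM2r ?sqr_ge0 // ler_wpM2l; lra.
(* With [1 - k/2 >= 1/2], the bound [v >= 7/5 u (1 - u)] suffices; it follows from [v2'] when [u] is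
   not small against [om^2]. Otherwise [u < 51/100], and [v2'] gives [v >= 86/100 u]. *)
have [hu|hu] := leP (102 / 100 * om ^+ 2) u.
  suff : 7 / 5 * u * (1 - u) <= v by nra.
  rewrite -(@ler_pXn2r _ 2) ?nnegrE //; last by nra.
  apply: le_trans v2'.
  have -> : (7 / 5 * u * (1 - u)) ^+ 2 = 49 / 25 * (1 - u) ^+ 2 * u ^+ 2 by field.
  rewrite ler_wpM2r ?sqr_ge0 //.
  have : (1 - 100 / 102 * u) * (2 - u) <= (1 - om ^+ 2) * (2 - u) by rewrite ler_wpM2r; lra.
  nra.
have hv : 86 / 100 * u <= v.
  rewrite -(@ler_pXn2r _ 2) ?nnegrE //; last by lra.
  apply: le_trans v2'; rewrite exprMn ler_wpM2r ?sqr_ge0 //.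
  have : 1 * (1 - u / 2) <= 2 * (1 - om ^+ 2) * (1 - u / 2) by rewrite ler_wpM2r; lra.
  lra.
pose l := 86 / 100 * u / om.
have lE : 86 / 100 * u = l * om by rewrite /l divfK ?gt_eqF.
have lk : l <= k by rewrite -(ler_pM2r om0) -lE -kE.
have l0 : 0 <= l by rewrite /l divr_ge0 ?ltW // mulr_gt0.
have lom : l <= 88 / 100 * om by rewrite -(ler_pM2r om0) -lE; nra.
(* The map [k (1 - k/2)] increases on [[0, 1]], so [k] may be replaced by its lower bound [l]; what
   remains is [quad]. *)
have mono : 0 <= om * ((k - l) * (1 - (k + l) / 2)).
  by apply: mulr_ge0; [exact: ltW | apply: mulr_ge0; lra].
have quad : 0 <= 16 / 100 - 43 / 100 * l + 7 / 10 * u.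
  have : l ^+ 2 <= 88 / 100 * (om * l) by nra.
  have := sqr_ge0 (l - 1 / 4); nra.
have := mulr_ge0 (ltW u0) quad.
rewrite kE; nra.
Qed.

(** [D] and [b] are the squared lengths of [x_{k+1} - x*] and [x_{k+1} - x_k], and [dp] is the inner
    product of [x_k - x_{k+1}] with [x_{k+1} - x*]; thus [D + 2 dp + b] is the previous squared
    distance. *)
Lemma contraction_scalar (s s_ th th_ om ka tau mu e q D b dp F_ : R) :
  0 < s_ -> 0 < s -> 0 <= th -> s = th * s_ -> 0 <= th_ -> 1 < tau ->
  0 < om -> om ^+ 2 <= 1 / 2 -> 0 < ka -> ka * (1 - om ^+ 2) = 1 ->
  0 < mu -> s * mu <= om ->
  th ^+ 2 <= 2 * (1 - om ^+ 2) + th_ / tau ->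
  0 <= q -> q <= mu / 2 * s_ -> q <= mu / 2 * s -> q <= 1 - tau^-1 ->
  q * (ka * om ^+ 2 + e) <= e ->
  0 <= D -> 0 <= b -> 0 <= F_ ->
  s_ * F_ <= dp + b - s_ * mu / 2 * (D + 2 * dp + b) ->
  2 * dp <= 2 / 5 * D + 5 / 2 * b ->
  (1 - (1 - mu * s / (2 * om)) * s * mu) * D
     + ka * (om ^+ 2 - 3 / 2 * s * th * mu) * b + ka * s * th * F_
  <= (1 - q) * (D + (ka * om ^+ 2 + e) * b + s_ * (2 + ka * th_) * F_).
Proof.
move=> s_0 s0 th0 sE th_0 tau1 om0 om2 ka0 kaE mu0 smu hth q0 qs_ qs qtau qe D0 b0 F0 hF hdp.
have om1 : 0 < 1 - om ^+ 2 by lra.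
have tauV : 0 < tau^-1 by rewrite invr_gt0; lra.
have sF0 : 0 <= s_ * F_ by rewrite mulr_ge0 // ltW.
have t1 : mu * s / (2 * om) <= 1 / 2 by rewrite ler_pdivrMr; lra.
have v0 : 0 < s * mu by rewrite mulr_gt0.
have eb : (1 - q) * ((ka * om ^+ 2 + e) * b) - ka * om ^+ 2 * b >= 0.
  have := ler_wpM2r b0 qe; lra.
have [easy|hard] := leP (th ^+ 2) ((1 - q) * (2 * (1 - om ^+ 2) + th_)).
  have h1 : ka * s * th * F_ <= (1 - q) * (s_ * (2 + ka * th_) * F_).
    have := ler_wpM2r sF0 (ler_wpM2l (ltW ka0) easy).
    have -> : 2 + ka * th_ = ka * (2 * (1 - om ^+ 2) + th_) by lra.
    rewrite sE; lra.
  have h2 : q * D <= (1 - mu * s / (2 * om)) * s * mu * D.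
    rewrite ler_wpM2r //; nra.
  have h3 : 0 <= ka * s * th * mu * b by rewrite !mulr_ge0 // ltW.
  lra.
have q1 : 0 <= 1 - q by lra.
have hw : 2 * (1 - om ^+ 2) * (1 - q) <= th ^+ 2 by nra.
have [||||u1 hA hB] := case_two (u := s_ * mu) (v := s * mu) _ q0 om0 om2 th0 _ smu _ _ hw.
- by rewrite mulr_gt0.
- by rewrite sE; ring.
- lra.
- lra.
(* The damping by [tau] enters here: [q <= 1 - 1/tau] makes the total coefficient of [th_]
   nonpositive, leaving [2 q (1 - om^2)]. *)
have exc : ka * (th ^+ 2 - (1 - q) * (2 * (1 - om ^+ 2) + th_)) <= 2 * q.
  have -> : 2 * q = ka * (2 * q * (1 - om ^+ 2))
    by rewrite mulrCA kaE mulr1.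
  rewrite (ler_wpM2l (ltW ka0)) //.
  have := ler_wpM2l th_0 qtau; lra.
have exc' : ka * s * th * F_ - (1 - q) * (s_ * (2 + ka * th_) * F_) <= 2 * q * (s_ * F_).
  have := ler_wpM2r sF0 exc.
  have -> : 2 + ka * th_ = ka * (2 * (1 - om ^+ 2) + th_) by lra.
  rewrite sE; lra.
have hD := ler_wpM2r D0 hA.
have hb := ler_wpM2r b0 (ler_wpM2l (ltW ka0) hB).
have hf := ler_wpM2l q0 hF.
(* The bound on [2 dp] is weighted by [q (1 - s_ mu)]. This gives
   [2/5 (1 - u) - u + 1 = 7/5 (1 - u)] for [D] and [5/2 (1 - u) + 2 - u] for [b], the coefficients
   in [case_two]. *)
have hd := ler_wpM2l (mulr_ge0 q0 (ltW (_ : 0 < 1 - s_ * mu))) hdp.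
have {}hd := hd ltac:(lra).
have kb : ka * (q * (5 / 2 * (1 - s_ * mu) + 2 - s_ * mu) * (1 - om ^+ 2)) * b
  = q * (5 / 2 * (1 - s_ * mu) + 2 - s_ * mu) * b.
  have -> : forall X, ka * (X * (1 - om ^+ 2)) = X * (ka * (1 - om ^+ 2)) by move=> X; ring.
  by rewrite kaE mulr1.
rewrite kb in hb.
have tE : s * mu * (1 - s * mu / (2 * om)) = (1 - mu * s / (2 * om)) * s * mu by ring.
rewrite tE in hD.
lra.
Qed.

End OneStep.

(** * The step-size rule and boundedness of the iterates *)

Section AdaSGA.
Variables (R : realType) (n : nat).
Variables (f : 'rV[R]_n -> R) (g : 'rV[R]_n -> 'rV[R]_n).
Hypothesis fg : is_gradient f g.
Hypothesis fconv : convex_fun f.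
Hypothesis flsc : locally_strongly_convex f g.
Hypothesis glip : locally_lipschitz g.
Variables (x : nat -> 'rV[R]_n) (s th : nat -> R) (tau om : R).
Hypothesis s0_gt0 : 0 < s 0.
Hypothesis th0_gt0 : 0 < th 0.
Hypothesis tau_gt1 : 1 < tau.
Hypothesis om_gt0 : 0 < om.
Hypothesis om_le : om ^+ 2 <= 1 / 2.
Hypothesis xS : forall k, x k.+1 = x k - s k *: g (x k).
Hypothesis sS : forall k, s k.+1 = Num.min
  (s k * Num.sqrt (2 * (1 - om ^+ 2) + th k / tau))
  (om / (enorm (g (x k.+1) - g (x k)) / enorm (x k.+1 - x k))).
Hypothesis thS : forall k, th k.+1 = s k.+1 / s k.
Variable xs : 'rV[R]_n.
Hypothesis xs_min : argmin f xs.

Let ka := (1 - om ^+ 2)^-1.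

Let kaE : ka * (1 - om ^+ 2) = 1.
Proof.
have o : 0 < 1 - om ^+ 2 by have := om_le; lra.
by rewrite /ka mulVf // gt_eqF.
Qed.

Let ka_gt0 : 0 < ka.
Proof. by rewrite /ka invr_gt0; have := om_le; lra. Qed.

(** Only nonnegativity holds in general: division by 0 gives 0, so the rule returns a zero step when
    successive gradients coincide. *)
Lemma step_ratio_ge0 k : 0 <= s k /\ 0 <= th k.
Proof.
elim: k => [|k [sk thk]]; first by split; exact: ltW.
have sk1 : 0 <= s k.+1.
  rewrite sS le_min mulr_ge0 ?sqrtr_ge0 //=.
  by rewrite divr_ge0 ?(ltW om_gt0) // divr_ge0 ?enorm_ge0.
by split => //; rewrite thS divr_ge0.
Qed.

(** If [s k = 0] the quotient carries no information, but the minimum then forces the next step to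
    be 0 too. *)
Lemma step_ratioE k : s k.+1 = th k.+1 * s k.
Proof.
rewrite thS; have [s0|sn0] := eqVneq (s k) 0; last by rewrite divfK.
rewrite s0 mulr0; apply/eqP; rewrite eq_le (step_ratio_ge0 k.+1).1 andbT.
by rewrite sS s0 mul0r ge_min lexx.
Qed.

Lemma ratio_sqr_le k : th k.+1 ^+ 2 <= 2 * (1 - om ^+ 2) + th k / tau.
Proof.
have [sk thk] := step_ratio_ge0 k; have [_ thk1] := step_ratio_ge0 k.+1.
have A0 : 0 <= 2 * (1 - om ^+ 2) + th k / tau.
  have om2 := om_le; have tau1 := tau_gt1.
  by rewrite addr_ge0 ?divr_ge0 //; lra.
rewrite -[leRHS](sqr_sqrtr A0) ler_pXn2r ?nnegrE ?sqrtr_ge0 //.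
have [s0|sn0] := eqVneq (s k) 0; first by rewrite thS s0 invr0 mulr0 sqrtr_ge0.
rewrite thS ler_pdivrMr; last by rewrite lt_neqAle eq_sym sn0.
by rewrite sS ge_min mulrC lexx.
Qed.

Lemma step_lipschitz k :
  s k.+1 * enorm (g (x k.+1) - g (x k)) <= om * enorm (x k.+1 - x k).
Proof.
set a := enorm (g _ - _); set b := enorm (_ - x k).
have [a0 b0] : 0 <= a /\ 0 <= b by rewrite !enorm_ge0.
have [->|an0] := eqVneq a 0; first by rewrite mulr0 mulr_ge0 // ltW.
have bn0 : b != 0.
  apply: contra an0 => b0'; rewrite /a; suff -> : x k.+1 = x k by rewrite subrr enorm0.
  apply/eqP; rewrite -subr_eq0; apply: contraT => /enorm_gt0.
  by rewrite -/b (eqP b0') ltxx.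
have : s k.+1 <= om / (a / b) by rewrite sS ge_min lexx orbT.
rewrite -(@ler_pM2r _ a) ?lt_neqAle ?(eq_sym 0) ?an0 // => /le_trans; apply.
by rewrite le_eqVlt; apply/orP; left; apply/eqP; field; rewrite bn0.
Qed.

Lemma step_lipschitz_sqr k :
  s k.+1 ^+ 2 * dot (g (x k.+1) - g (x k)) (g (x k.+1) - g (x k)) <=
  om ^+ 2 * dot (x k.+1 - x k) (x k.+1 - x k).
Proof.
rewrite -!sqr_enorm -!exprMn ler_pXn2r ?nnegrE ?step_lipschitz //.
  by rewrite mulr_ge0 ?enorm_ge0 ?(step_ratio_ge0 _).1.
by rewrite mulr_ge0 ?enorm_ge0 // ltW.
Qed.

Let F k := f (x k) - f xs.
Let D k := dot (x k - xs) (x k - xs).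
Let G k := s k ^+ 2 * dot (g (x k)) (g (x k)).

Let F_ge0 k : 0 <= F k.
Proof. by rewrite subr_ge0 xs_min. Qed.

Let D_ge0 k : 0 <= D k. Proof. exact: dot_ge0. Qed.

Let G_ge0 k : 0 <= G k.
Proof. by rewrite mulr_ge0 ?sqr_ge0 ?dot_ge0. Qed.

Let GE k : dot (x k.+1 - x k) (x k.+1 - x k) = G k.
Proof. by rewrite xS addrC addKr !dotE /G; ring. Qed.

Let gx_ge k : F k <= dot (g (x k)) (x k - xs).
Proof.
have := convex_gradient_le fconv flsc (x k) xs.
by rewrite /F -(opprB (x k)) dotNr; lra.
Qed.

(* The Lyapunov function without the strong convexity constant; it decreases on
   all of the space and so confines the iterates before any local constant is
   available. *)
Let lyap k := D k.+1 + ka * om ^+ 2 * G k + s k * (2 + ka * th k) * F k.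

Lemma lyap_nonincreasing k : lyap k.+1 <= lyap k.
Proof.
have [sk thk] := step_ratio_ge0 k; have [sk1 thk1] := step_ratio_ge0 k.+1.
(* The parameters [mu], [e] and [r] are 0: only convexity and plain monotonicity are available
   globally. *)
have := @lyapunov_one_step R n (x k.+1) (x k) xs (g (x k.+1)) (g (x k)) (s k.+1) (s k)
  (th k.+1) om ka 0 0 0 (F k.+1) (F k) sk1 thk1 (step_ratioE k) (xS k) (ltW ka_gt0) kaE
  (step_lipschitz_sqr k).
rewrite -xS -/(G k.+1) -/(D k.+1) -/(D k.+2) GE => H.
apply: (@le_trans _ _ (D k.+1 + ka * om ^+ 2 * G k + ka * s k.+1 * th k.+1 * F k)).
  rewrite /lyap; have := H _ _ _; rewrite !(mul0r, mulr0, addr0, subr0, mul1r, mulrA).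
  apply.
  - have := convex_gradient_le fconv flsc (x k.+1) (x k).
    by rewrite /F; lra.
  - exact: (gradient_monotone fconv flsc).
  - by rewrite -mulrA -[leRHS]mulrA ler_wpM2l // ler_wpM2l.
rewrite /lyap lerD2l step_ratioE.
have h : th k.+1 ^+ 2 <= 2 * (1 - om ^+ 2) + th k.
  apply: le_trans (ratio_sqr_le k) _; rewrite lerD2l ler_pdivrMr; last by have := tau_gt1; lra.
  by rewrite ler_peMr // ltW.
have := ler_wpM2r (mulr_ge0 sk (F_ge0 k)) (ler_wpM2l (ltW ka_gt0) h).
have -> : 2 + ka * th k = ka * (2 * (1 - om ^+ 2) + th k) by have := kaE; lra.
lra.
Qed.

(** [D k] is at most [lyap 0] for [k >= 1]. Expanding [D 1], convexity cancels [2 s_0 F_0], and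
    [ka <= 2] bounds the rest. *)
Lemma iterates_bounded k :
  D k <= D 0 + 2 * s 0 ^+ 2 * dot (g (x 0)) (g (x 0)) + 2 * s 0 * th 0 * F 0.
Proof.
have sF : 0 <= s 0 * F 0 by rewrite mulr_ge0 // ltW.
have stF : 0 <= th 0 * (s 0 * F 0) by rewrite mulr_ge0 // ltW.
case: k => [|k].
  by have := G_ge0 0; rewrite /G; lra.
have ka2 : ka <= 2.
  by have := kaE; have := om_le; have := ka_gt0; nra.
have : lyap k <= lyap 0.
  by elim: k => [|k IH]; [exact: lexx|exact: le_trans (lyap_nonincreasing k) IH].
have [sk thk] := step_ratio_ge0 k.
have ka0 := ka_gt0.
have h1 : 0 <= ka * om ^+ 2 * G k.
  by apply: mulr_ge0 => //; apply: mulr_ge0; [exact: ltW|exact: sqr_ge0].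
have h2 : 0 <= s k * (2 + ka * th k) * F k.
  by apply: mulr_ge0 => //; apply: mulr_ge0 => //; rewrite addr_ge0 // mulr_ge0 // ltW.
have h3 : D 1 = D 0 - 2 * s 0 * dot (g (x 0)) (x 0 - xs) + G 0.
  rewrite /D xS addrAC /G !dotE (dotC (x 0) (g _)) (dotC xs (g _)); ring.
have h4 := ler_wpM2l (ltW s0_gt0) (gx_ge 0).
have h5 := ler_wpM2r (G_ge0 0) ka2.
have h6 := ler_wpM2r stF ka2.
have h7 : ka * om ^+ 2 * G 0 = ka * G 0 - G 0.
  have -> : ka * om ^+ 2 = ka - 1 by have := kaE; lra.
  ring.
have G0 : G 0 = s 0 ^+ 2 * dot (g (x 0)) (g (x 0)) by [].
move: h3 h5 h7; rewrite /lyap => -> h5 -> ?; lra.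
Qed.

(** * Linear contraction with constants valid on a ball containing the iterates *)

Variables (r L mu : R).
Hypothesis L_gt0 : 0 < L.
Hypothesis mu_gt0 : 0 < mu.
Hypothesis g_strong : forall y z, enorm y <= r -> enorm z <= r ->
  mu * dot (z - y) (z - y) <= dot (g z - g y) (z - y).
Hypothesis g_lip : forall y z, enorm y <= r -> enorm z <= r ->
  enorm (g y - g z) <= L * enorm (y - z).
Hypothesis x_ball : forall k, enorm (x k) <= r.
Hypothesis xs_ball : enorm xs <= r.
Hypothesis xs_step_ball : forall k, enorm (xs + L^-1 *: g (x k)) <= r.

Let gxs : g xs = 0.
Proof. exact: (argmin_gradient fconv flsc glip xs_min). Qed.

Lemma gradient_neq0 k : x k != xs -> g (x k) != 0.
Proof.
apply: contra => /eqP gx; have := g_strong xs_ball (x_ball k).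
rewrite gx gxs subrr dot0l pmulr_rle0 // => D0.
rewrite -subr_eq0; apply/eqP/dot_eq0/eqP.
by rewrite eq_le D0 dot_ge0.
Qed.

Lemma gradient_diff_lower k : mu * enorm (x k.+1 - x k) <= enorm (g (x k.+1) - g (x k)).
Proof.
have [e0|en0] := eqVneq (x k.+1 - x k) 0; first by rewrite e0 enorm0 mulr0 enorm_ge0.
rewrite -(ler_pM2r (enorm_gt0 en0)); apply: le_trans (dot_le_enorm _ _).
by rewrite -mulrA -expr2 sqr_enorm g_strong.
Qed.

(** Away from [xs] the local Lipschitz quotient is positive and at most [L], and the square root is
    at least 1 because [2 (1 - om^2) >= 1]. At [xs] the step may collapse to 0, hence the
    alternative. *)
Lemma step_lower_bound k : x k = xs \/ Num.min (s 0) (om / L) <= s k.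
Proof.
have smin0 : 0 < Num.min (s 0) (om / L) by rewrite lt_min s0_gt0 divr_gt0.
elim: k => [|k IH]; first by right; rewrite ge_min lexx.
have [xk|xk] := eqVneq (x k) xs; first by left; rewrite xS xk gxs scaler0 subr0.
case: IH => [/eqP|sk]; first by rewrite (negbTE xk).
right; have s_gt0 := lt_le_trans smin0 sk.
have dx : x k.+1 - x k != 0.
  by rewrite xS addrC addKr oppr_eq0 scaler_eq0 negb_or gt_eqF // gradient_neq0.
have b0 := enorm_gt0 dx.
have a0 := lt_le_trans (mulr_gt0 mu_gt0 b0) (gradient_diff_lower k).
rewrite sS le_min; apply/andP; split.
  apply: le_trans sk _; apply: ler_peMr; first exact: ltW.
  rewrite -[leLHS]sqrtr1 ler_wsqrtr //.
  have [_ thk] := step_ratio_ge0 k; have om2 := om_le; have tau1 := tau_gt1.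
  have : 0 <= th k / tau by rewrite divr_ge0; lra.
  lra.
apply: (@le_trans _ _ (om / L)); first by rewrite ge_min lexx orbT.
rewrite ler_pM2l // lef_pV2 ?posrE ?divr_gt0 // ler_pdivrMr //.
exact: g_lip.
Qed.

(** At [y = xs + g(x_k) / L], compare the tangent bound from [x_k] with the descent bound from [xs],
    where the gradient vanishes. *)
Lemma cocoercive_gap k :
  F k + (2 * L)^-1 * dot (g (x k)) (g (x k)) <= dot (g (x k)) (x k - xs).
Proof.
pose y := xs + L^-1 *: g (x k).
have := descent_ball fg g_lip (xs_step_ball k) xs_ball.
rewrite gxs dot0l addr0 -/y.
have -> : y - xs = L^-1 *: g (x k) by rewrite /y addrC addKr.
have := convex_gradient_le fconv flsc (x k) y.
have -> : y - x k = L^-1 *: g (x k) - (x k - xs).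
  by rewrite /y opprB addrAC [in RHS]addrC addrC addrA addrAC.
rewrite !dotE /F.
set a := dot (g (x k)) (g (x k)).
have -> : L / 2 * (L^-1 * (L^-1 * a)) = (2 * L)^-1 * a by field; rewrite gt_eqF.
have -> : L^-1 * a = 2 * ((2 * L)^-1 * a) by field; rewrite gt_eqF.
lra.
Qed.

Lemma strong_gap k : F k + mu / 2 * D k <= dot (g (x k)) (x k - xs).
Proof.
have := strong_convexity_ball fg g_strong xs_ball (x_ball k).
by rewrite /F /D -(opprB (x k) xs) !dotNr !dotNl; lra.
Qed.

Let e := mu / (2 * om * L).

Lemma lyapunov_contraction q :
  0 <= q -> q <= mu / 2 * Num.min (s 0) (om / L) -> q <= 1 - tau^-1 ->
  q * (ka * om ^+ 2 + e) <= e ->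
  forall k,
  D k.+2 + (ka * om ^+ 2 + e) * G k.+1 + s k.+1 * (2 + ka * th k.+1) * F k.+1 <=
  (1 - q) * (D k.+1 + (ka * om ^+ 2 + e) * G k + s k * (2 + ka * th k) * F k).
Proof.
move=> q0 qs qtau qe k.
have e0 : 0 < e by rewrite /e divr_gt0 // !mulr_gt0.
have [sk thk] := step_ratio_ge0 k; have [sk1 thk1] := step_ratio_ge0 k.+1.
have om2 := om_le; have tau1 := tau_gt1; have om0 := om_gt0.
have kagt0 := ka_gt0; have kae := kaE; have mu0 := mu_gt0; have L0 := L_gt0.
have tauV : 0 < tau^-1 by rewrite invr_gt0; lra.
have c0 : 0 <= ka * om ^+ 2 + e by rewrite addr_ge0 ?(ltW e0) // mulr_ge0 ?sqr_ge0 // ltW.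
(* At the minimizer the left side is 0, and no positive step is needed. *)
have [xk1|xk1] := eqVneq (x k.+1) xs.
  have -> : D k.+2 = 0 by rewrite /D xS xk1 gxs scaler0 subr0 subrr dot0l.
  have -> : G k.+1 = 0 by rewrite /G xk1 gxs dot0l mulr0.
  have -> : F k.+1 = 0 by rewrite /F xk1 subrr.
  rewrite !mulr0 !addr0; apply: mulr_ge0; first by lra.
  apply: addr_ge0; first by apply: addr_ge0 => //; apply: mulr_ge0.
  by apply: mulr_ge0 => //; apply: mulr_ge0 => //; rewrite addr_ge0 // mulr_ge0 // ltW.
have xk : x k != xs.
  by apply: contra xk1 => /eqP xk; rewrite xS xk gxs scaler0 subr0.
have smin0 : 0 < Num.min (s 0) (om / L) by rewrite lt_min s0_gt0 divr_gt0.
have ms : Num.min (s 0) (om / L) <= s k.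
  by case: (step_lower_bound k) => // /eqP; rewrite (negbTE xk).
have ms1 : Num.min (s 0) (om / L) <= s k.+1.
  by case: (step_lower_bound k.+1) => // /eqP; rewrite (negbTE xk1).
have sgt0 := lt_le_trans smin0 ms; have s1gt0 := lt_le_trans smin0 ms1.
have dx : x k.+1 - x k != 0.
  by rewrite xS addrC addKr oppr_eq0 scaler_eq0 negb_or gt_eqF // gradient_neq0.
have smu : s k.+1 * mu <= om.
  rewrite -(ler_pM2r (enorm_gt0 dx)); apply: le_trans (step_lipschitz k).
  by rewrite -mulrA ler_pM2l // gradient_diff_lower.
(* Weights [t] and [1 - t] mix the strong convexity and cocoercivity gaps; the second then
   contributes [2 s (1 - t) / (2 L) = e s^2], which fixes [e]. *)
pose t := 1 - mu * s k.+1 / (2 * om).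
have tE : s k.+1 * mu = (1 - t) * (2 * om).
  by rewrite /t; field; rewrite gt_eqF.
have t1 : 0 <= 1 - t by rewrite /t opprB addrC subrK divr_ge0 ?mulr_ge0 // ltW.
have t0 : 0 <= t.
  by rewrite /t subr_ge0 ler_pdivrMr ?mulr_gt0 //; lra.
have := @lyapunov_one_step R n (x k.+1) (x k) xs (g (x k.+1)) (g (x k)) (s k.+1) (s k)
  (th k.+1) om ka mu e (t * s k.+1 * mu) (F k.+1) (F k) sk1 thk1 (step_ratioE k) (xS k)
  (ltW ka_gt0) kaE (step_lipschitz_sqr k).
rewrite -xS -/(G k.+1) -/(D k.+1) -/(D k.+2) GE => H.
apply: le_trans (H _ _ _) _.
- have := strong_convexity_ball fg g_strong (x_ball k) (x_ball k.+1); rewrite /F; lra.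
- by rewrite -GE g_strong.
- have hA := ler_wpM2l t0 (strong_gap k.+1).
  have hB := ler_wpM2l t1 (cocoercive_gap k.+1).
  have hC := ler_wpM2l sk1 (lerD hA hB).
  have -> : e * s k.+1 ^+ 2 * dot (g (x k.+1)) (g (x k.+1)) =
    2 * (s k.+1 * ((1 - t) * ((2 * L)^-1 * dot (g (x k.+1)) (g (x k.+1))))).
    by rewrite /e /t; field; rewrite !gt_eqF.
  lra.
have qle c : Num.min (s 0) (om / L) <= c -> q <= mu / 2 * c.
  by move=> mc; apply: le_trans qs _; rewrite ler_wpM2l // divr_ge0 // ltW.
have xd : x k - x k.+1 = s k *: g (x k) by rewrite xS opprB addrC subrK.
have xp : x k - xs = (x k.+1 - xs) + (x k - x k.+1) by rewrite [RHS]addrC addrA subrK.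
have GE' : dot (x k - x k.+1) (x k - x k.+1) = G k by rewrite xd !dotE /G; ring.
apply: (contraction_scalar (dp := dot (x k - x k.+1) (x k.+1 - xs)) sgt0 s1gt0 thk1
  (step_ratioE k) thk tau1 om0 om2 kagt0 kae mu0 smu (ratio_sqr_le k) q0 (qle _ ms)
  (qle _ ms1) qtau qe (D_ge0 _) (G_ge0 _) (F_ge0 _)).
- have := ler_wpM2l sk (strong_gap k).
  have -> : s k * dot (g (x k)) (x k - xs) = dot (x k - x k.+1) (x k.+1 - xs) + G k.
    by rewrite -dotZl -xd xp dotDr GE'.
  have -> : D k = D k.+1 + 2 * dot (x k - x k.+1) (x k.+1 - xs) + G k.
    have dd (a b : 'rV[R]_n) : dot (a + b) (a + b) = dot a a + 2 * dot b a + dot b b.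
      by rewrite dotDl !dotDr (dotC a b); ring.
    by rewrite {1}/D xp dd GE'.
  lra.
(* Young's inequality with weights [2/5] and [5/2], as a square expanded. *)
- have dd (a b : 'rV[R]_n) : dot (2 *: a - 5 *: b) (2 *: a - 5 *: b) =
      4 * dot a a - 20 * dot b a + 25 * dot b b.
    by rewrite !dotE (dotC a b); ring.
  by have := dot_ge0 (2 *: (x k.+1 - xs) - 5 *: (x k - x k.+1)); rewrite dd GE' -/(D k.+1); lra.
Qed.

End AdaSGA.

(** * The constant [mu_W] as an infimum *)

Section Modulus.
Variables (R : realType) (n : nat) (g : 'rV[R]_n -> 'rV[R]_n) (r : R).

Definition monotonicity_modulus : R :=
  inf [set q : R | exists y z : 'rV[R]_n,
    [/\ enorm y <= r, enorm z <= r, y != z &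
        q = dot (g z - g y) (z - y) / enorm (z - y) ^+ 2]].

Lemma monotonicity_modulus_le :
  (forall y z, 0 <= dot (g z - g y) (z - y)) ->
  forall y z, enorm y <= r -> enorm z <= r ->
  monotonicity_modulus * dot (z - y) (z - y) <= dot (g z - g y) (z - y).
Proof.
move=> gmono y z yr zr; have [->|yz] := eqVneq y z.
  by rewrite !subrr dot0l mulr0.
have zy0 : 0 < dot (z - y) (z - y).
  by rewrite -sqr_enorm exprn_gt0 // enorm_gt0 // subr_eq0 eq_sym.
rewrite -ler_pdivlMr // -sqr_enorm; apply: ge_inf; last by exists y, z.
exists 0 => _ [u [v [_ _ _ ->]]]; rewrite divr_ge0 ?gmono //.
exact: sqr_ge0.
Qed.

(** An empty infimum would be 0, so a pair of distinct points is exhibited: the origin and a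
    constant vector scaled to length [r]. *)
Lemma monotonicity_modulus_gt0 (f : 'rV[R]_n -> R) : (0 < n)%N -> 0 < r ->
  locally_strongly_convex f g -> 0 < monotonicity_modulus.
Proof.
move=> n0 r0 /(strongly_monotone_ball r)[c c0 H].
apply: lt_le_trans c0 _; apply: lb_le_inf => [|_ [y [z [yr zr yz ->]]]]; last first.
  rewrite ler_pdivlMr ?exprn_gt0 ?enorm_gt0 ?subr_eq0 1?eq_sym //.
  by rewrite sqr_enorm H.
pose v : 'rV[R]_n := const_mx 1.
have v0 : v != 0.
  apply/eqP => /rowP/(_ (Ordinal n0)); rewrite !mxE => /eqP.
  by rewrite oner_eq0.
have ev := enorm_gt0 v0.
exists (dot (g ((r / enorm v) *: v) - g 0) ((r / enorm v) *: v - 0) /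
  enorm ((r / enorm v) *: v - 0) ^+ 2).
exists 0, ((r / enorm v) *: v); split => //.
- by rewrite enorm0 ltW.
- by rewrite enormZ gtr0_norm ?divr_gt0 // divfK // gt_eqF.
- by rewrite eq_sym scaler_eq0 negb_or v0 gt_eqF // divr_gt0.
Qed.

End Modulus.

(** * Assembly: confinement to [W] and the three bounds on [qhat] *)

Unset Implicit Arguments.

Theorem theorem4p5 (R : realType) (n : nat) (hn : (0 < n)%N)
  (f : 'rV[R]_n -> R) (g : 'rV[R]_n -> 'rV[R]_n)
  (hgrad : is_gradient f g) (hC1 : continuous g)
  (hconv : convex_fun f) (hlsc : locally_strongly_convex f g)
  (hlip : locally_lipschitz g)
  (hXne : argmin f !=set0)
  (fstar : R) (hfstar : forall xs, argmin f xs -> f xs = fstar)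
  (x : nat -> 'rV[R]_n) (alpha theta gamma : nat -> R)
  (tau omega gmin gmax : R)
  (halpha0 : 0 < alpha 0) (htheta0 : 0 < theta 0) (htau : 1 < tau)
  (homega : 0 < omega) (homega' : omega <= 1 / Num.sqrt 2)
  (hgmin : 0 < gmin) (hgam : forall k, gmin <= gamma k <= gmax)
  (hx : forall k, x k.+1 = x k - (alpha k * gamma k) *: g (x k))
  (halpha : forall k, (0 < k)%N ->
     alpha k = Num.min
       (alpha k.-1 * gamma k.-1 / gamma k *
          Num.sqrt (2 * (1 - omega ^+ 2) + theta k.-1 / tau))
       (omega / (gamma k *
          (enorm (g (x k) - g (x k.-1)) / enorm (x k - x k.-1)))))
  (htheta : forall k, (0 < k)%N ->
     theta k = alpha k * gamma k / (alpha k.-1 * gamma k.-1))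
  (RW LW : R)
  (hR : 3 * Num.sqrt (dist_set (x 0) (argmin f) ^+ 2
            + 2 * alpha 0 ^+ 2 * gamma 0 ^+ 2 * enorm (g (x 0)) ^+ 2
            + 2 * alpha 0 * gamma 0 * theta 0 * (f (x 0) - fstar))
        + dist_set (x 0) (argmin f) + enorm (x 0) < RW)
  (hLW : 0 < LW)
  (hLWlip : forall y z : 'rV[R]_n, enorm y <= RW -> enorm z <= RW ->
      enorm (g y - g z) <= LW * enorm (y - z))
  (xs : 'rV[R]_n) (hxs : argmin f xs) :
  let muW := inf [set q : R | exists y z : 'rV[R]_n,
                    [/\ enorm y <= RW, enorm z <= RW, y != z &
                        q = dot (g z - g y) (z - y) / enorm (z - y) ^+ 2]] in
  let m := Num.min (alpha 0 * gamma 0 * muW / omega) (muW / LW) in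
  let qhat := Num.min (Num.min
       (muW / 2 * Num.min (alpha 0 * gamma 0) (omega / LW))
       (muW * (1 - omega ^+ 2) / (2 * omega ^+ 3 * LW + muW * (1 - omega ^+ 2))))
       ((tau - 1) * m / (tau * (2 * (1 - omega ^+ 2) + m))) in
  let Lhat (k : nat) :=
    enorm (x k.+1 - xs) ^+ 2
    + (omega ^+ 2 / (1 - omega ^+ 2) + muW / (2 * omega * LW))
        * enorm (x k.+1 - x k) ^+ 2
    + 2 * alpha k * gamma k * (1 + theta k / (2 * (1 - omega ^+ 2)))
        * (f (x k) - fstar) in
  (0 < qhat < 1) /\
  (forall k : nat, (0 < k)%N -> Lhat k <= (1 - qhat) * Lhat k.-1).
Proof.
move=> muW m qhat Lhat.
have om2 : omega ^+ 2 <= 1 / 2.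
  have s2 : (0 : R) < Num.sqrt 2 by rewrite sqrtr_gt0.
  have : omega ^+ 2 <= (1 / Num.sqrt 2) ^+ 2.
    by rewrite ler_pXn2r // nnegrE ltW // divr_gt0.
  by rewrite expr_div_n expr1n sqr_sqrtr.
have om1 : 0 < 1 - omega ^+ 2 by lra.
(* With a unique minimizer the distance in [eta] is the distance to [xs]. *)
have argminE : argmin f = [set xs].
  apply/seteqP; split => [y /=|y ->//].
  exact: (argmin_unique hconv hlsc hlip).
have gam0 k : 0 < gamma k by apply: lt_le_trans hgmin _; case/andP: (hgam k).
(* In terms of the product, [gamma] cancels from the step-size rule. *)
pose s k := alpha k * gamma k.
have s0 : 0 < s 0 by rewrite mulr_gt0.
have xS k : x k.+1 = x k - s k *: g (x k) by exact: hx.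
have thS k : theta k.+1 = s k.+1 / s k by exact: htheta.
have sS k : s k.+1 = Num.min (s k * Num.sqrt (2 * (1 - omega ^+ 2) + theta k / tau))
    (omega / (enorm (g (x k.+1) - g (x k)) / enorm (x k.+1 - x k))).
  rewrite /s halpha //= minr_pMl ?ltW //; congr Num.min.
    by rewrite mulrAC divfK ?gt_eqF.
  by rewrite invfM [(gamma _)^-1 * _]mulrC mulrA divfK ?gt_eqF.
have fsE : fstar = f xs by rewrite hfstar.
have xsF k : 0 <= f (x k) - f xs by rewrite subr_ge0 hxs.
have dE : dist_set (x 0) (argmin f) = enorm (x 0 - xs).
  by rewrite /dist_set argminE image_set1 inf1 enormB.
have Dle := iterates_bounded hconv hlsc s0 htheta0 htau homega om2 xS sS thS hxs.
set eta := (_ ^+ 2 + _ + _) in hR.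
have etaE : eta = dot (x 0 - xs) (x 0 - xs) + 2 * s 0 ^+ 2 * dot (g (x 0)) (g (x 0))
    + 2 * s 0 * theta 0 * (f (x 0) - f xs).
  by rewrite /eta dE !sqr_enorm fsE /s; ring.
have {}Dle k : enorm (x k - xs) <= Num.sqrt eta.
  by rewrite ler_wsqrtr // etaE.
have eta0 := sqrtr_ge0 eta.
rewrite dE in hR.
have dx0 := enorm_ge0 (x 0 - xs).
have ex0 := enorm_ge0 (x 0).
have exs : enorm xs <= enorm (x 0) + enorm (x 0 - xs).
  have -> : xs = x 0 + - (x 0 - xs) by rewrite opprB addrC subrK.
  by apply: le_trans (enormD _ _) _; rewrite enormN opprD addrA subrr add0r opprK.
have RW0 : 0 < RW by lra.
have xs_ball : enorm xs <= RW by lra.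
have x_ball k : enorm (x k) <= RW.
  have := enormD (x k - xs) xs; rewrite subrK; have := Dle k; lra.
have gxs := argmin_gradient hconv hlsc hlip hxs.
(* Since [g xs = 0], the Lipschitz bound makes [|g(x_k)| / LW] at most [sqrt eta], within the slack
   left in [RW]. *)
have gstep_ball k : enorm (xs + LW^-1 *: g (x k)) <= RW.
  apply: le_trans (enormD _ _) _; rewrite enormZ gtr0_norm ?invr_gt0 //.
  have : LW^-1 * enorm (g (x k)) <= enorm (x k - xs).
    by rewrite ler_pdivrMl // -[g (x k)]subr0 -gxs hLWlip.
  have := Dle k; lra.
have gmono := gradient_monotone hconv hlsc.
have mu0 : 0 < muW by exact: (monotonicity_modulus_gt0 hn RW0 hlsc).
have gstrong : forall y z, enorm y <= RW -> enorm z <= RW ->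
    muW * dot (z - y) (z - y) <= dot (g z - g y) (z - y).
  by apply: monotonicity_modulus_le => y z; exact: gmono.
have m0 : 0 < m by rewrite lt_min !divr_gt0 // mulr_gt0.
have tau0 : 0 < tau by lra.
have den2 : 0 < 2 * omega ^+ 3 * LW + muW * (1 - omega ^+ 2).
  by rewrite addr_gt0 // !mulr_gt0 ?exprn_gt0.
have den3 : 0 < 2 * (1 - omega ^+ 2) + m by lra.
have q1 : qhat <= muW / 2 * Num.min (s 0) (omega / LW) by rewrite /qhat !ge_min lexx.
have q2 : qhat <= muW * (1 - omega ^+ 2) / (2 * omega ^+ 3 * LW + muW * (1 - omega ^+ 2)).
  by rewrite /qhat !ge_min lexx orbT.
have q3 : qhat <= 1 - tau^-1.
  apply: (@le_trans _ _ ((tau - 1) * m / (tau * (2 * (1 - omega ^+ 2) + m)))).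
    by rewrite /qhat ge_min lexx orbT.
  rewrite ler_pdivrMr ?mulr_gt0 //.
  have -> : (1 - tau^-1) * (tau * (2 * (1 - omega ^+ 2) + m)) =
      (tau - 1) * (2 * (1 - omega ^+ 2) + m).
    by field; rewrite gt_eqF.
  by rewrite ler_pM2l; lra.
have q0 : 0 < qhat.
  rewrite /qhat !lt_min; apply/andP; split; first (apply/andP; split).
  - by rewrite mulr_gt0 ?divr_gt0 // lt_min s0 divr_gt0.
  - by rewrite divr_gt0 ?mulr_gt0.
  - by rewrite divr_gt0 ?mulr_gt0 // subr_gt0.
split.
  rewrite q0 /=; apply: le_lt_trans q3 _.
  by rewrite ltrBlDr ltrDl invr_gt0.
(* The second entry of [qhat] is exactly the value of [q] that gives equality here. *)
have qe : qhat * ((1 - omega ^+ 2)^-1 * omega ^+ 2 + muW / (2 * omega * LW)) <=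
    muW / (2 * omega * LW).
  have c0 : 0 <= (1 - omega ^+ 2)^-1 * omega ^+ 2 + muW / (2 * omega * LW).
    by rewrite addr_ge0 // ?mulr_ge0 ?invr_ge0 ?sqr_ge0 ?mulr_ge0 // ltW.
  apply: le_trans (ler_wpM2r c0 q2) _; rewrite le_eqVlt; apply/orP; left; apply/eqP.
  by field; rewrite !gt_eqF.
have LhatE k : Lhat k = dot (x k.+1 - xs) (x k.+1 - xs)
    + ((1 - omega ^+ 2)^-1 * omega ^+ 2 + muW / (2 * omega * LW))
      * (s k ^+ 2 * dot (g (x k)) (g (x k)))
    + s k * (2 + (1 - omega ^+ 2)^-1 * theta k) * (f (x k) - f xs).
  rewrite /Lhat !sqr_enorm fsE; congr (_ + _ + _).
    congr (_ * _); first by rewrite mulrC.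
    by rewrite xS addrC addKr !dotE; ring.
  by rewrite /s; field; rewrite gt_eqF.
case=> [//|k] _; rewrite !LhatE.
exact: (lyapunov_contraction hgrad hconv hlsc hlip s0 htheta0 htau homega om2 xS sS thS hxs
  hLW mu0 gstrong hLWlip x_ball xs_ball gstep_ball (ltW q0) q1 q3 qe).
Qed.
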